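(* For every integer $k\geq 1$ there is a polynomial $S_k(n)$ in $n$ of degree $4k$ with rational coefficients such that \[ \pi=\sum_{n=0}^\infty \frac{S_k(n)}{\binom{8kn}{4kn}(-4)^{kn}}. \] *)

(* Defs.v *)
From HB Require Import structures.
From mathcomp Require Import all_boot all_order all_algebra.
From mathcomp Require Import all_classical all_reals all_analysis.
Set Implicit Arguments. Unset Strict Implicit. Unset Printing Implicit Defensive.
Import Order.TTheory GRing.Theory Num.Theory.
Local Open Scope ring_scope.

Definition pi_term (R : realType) (k : nat) (S : {poly rat}) (n : nat) : R :=
  ratr (S.[n%:R]) / ('C(8 * k * n, 4 * k * n)%:R * (-4) ^+ (k * n)).

(* Main.v *)
Require Import Defs.
From HB Require Import structures.
From mathcomp Require Import all_boot all_order all_algebra.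
From mathcomp Require Import all_classical all_reals all_analysis.
From mathcomp Require Import ring lra zify.
Import Order.TTheory GRing.Theory Num.Theory numFieldNormedType.Exports.
Local Open Scope classical_set_scope.
Local Open Scope ring_scope.

(** Put y = x (1 - x), K = 4 k, and let a_m be the Taylor coefficients of
(6 - 4 y) / (2 - 2 y + y^2) = 2 / (1 + x^2) + 2 / (1 + (x - 1)^2).  Integrating over [0, 1] gives
pi = sum_m a_m / ((2 m + 1) C(2 m, m)).  Since a_(m + 4) = - a_m / 4, grouping the terms m = K n + j
with j < K turns this into pi = sum_n R(K n) t_n, where t_n = 1 / (C(2 K n, K n) (-4)^(k n)) and
R(N) = sum_(s < K) rho_s / (2 N + 2 s + 1).  Adding G(n + 1) t_(n + 1) - G(n) t_n for a suitable
polynomial G with G(0) = 0 cancels each simple pole and leaves a polynomial S of degree at most K.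

The coefficient of degree K of S is a nonzero multiple of sum_(l < K) m_l / (2 l + 1), where
m_l = - Im ((1 - 2 i)^(2 l + 1)) / 2.  No m_l is divisible by 3, and exactly one denominator
2 l + 1 < 2 K is divisible by the largest power of 3 below 2 K; so the sum is not zero. *)

(** * Generalized binomial coefficients and their convolution with simple poles *)

Definition gbin {F : fieldType} (x : F) n : F := \prod_(i < n) ((x - i%:R) / i.+1%:R).

Lemma gbin0 (F : fieldType) (x : F) : gbin x 0 = 1.
Proof. by rewrite /gbin big_ord0. Qed.

Lemma gbinS (F : realFieldType) (x : F) n : n.+1%:R * gbin x n.+1 = (x - n%:R) * gbin x n.
Proof.
by rewrite /gbin big_ord_recr /= mulrCA [RHS]mulrC; congr (_ * _); rewrite mulrC divfK ?pnatr_eq0.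
Qed.

Lemma gbin_nat (F : realFieldType) m n : gbin (m%:R : F) n = 'C(m, n)%:R.
Proof.
elim: n => [|n IH]; first by rewrite gbin0 bin0.
apply: (mulfI (_ : n.+1%:R != 0)); first by rewrite pnatr_eq0.
rewrite gbinS IH -natrM mul_bin_left natrM.
have [le_nm|lt_mn] := leqP n m; first by rewrite natrB.
by rewrite bin_small // !mulr0.
Qed.

Lemma gbin_pascal (F : realFieldType) (x : F) n :
  gbin (x + 1) n.+1 = gbin x n.+1 + gbin x n.
Proof.
elim: n => [|n IH].
  by rewrite /gbin !big_ord_recr !big_ord0 /=; field.
apply: (mulfI (_ : n.+2%:R != 0)); first by rewrite pnatr_eq0.
rewrite gbinS IH [RHS]mulrDr [in RHS]gbinS.
have -> : x + 1 - n.+1%:R = x - n%:R by ring.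
by rewrite [LHS]mulrDr -[(x - n%:R) * gbin x n]gbinS; ring.
Qed.

Lemma gbin_vandermonde (F : realFieldType) (x y : F) n :
  \sum_(s < n.+1) gbin x s * gbin y (n - s) = gbin (x + y) n.
Proof.
elim: n => [|n IH]; first by rewrite big_ord1 !gbin0 mulr1.
apply: (mulfI (_ : n.+1%:R != 0)); first by rewrite pnatr_eq0.
rewrite gbinS -IH !mulr_sumr.
under eq_bigr => s _ do
  have -> : n.+1%:R * (gbin x s * gbin y (n.+1 - s)) =
    (s%:R * gbin x s) * gbin y (n.+1 - s) + gbin x s * ((n.+1 - s)%:R * gbin y (n.+1 - s))
    by have := leq_ord s; move=> /natrB ->; ring.
rewrite big_split /= [X in X + _]big_ord_recl [X in _ + X]big_ord_recr /= !mul0r add0r.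
rewrite subnn !mul0r mulr0 addr0 -big_split /=; apply: eq_bigr => s _.
rewrite /bump leq0n add1n subSS gbinS subSn ?leq_ord // gbinS natrB ?leq_ord //; ring.
Qed.

Definition gconv {F : fieldType} (x y u : F) n : F :=
  \sum_(s < n.+1) gbin x s * gbin y (n - s) / (u + s%:R).

(* Both recurrences below come from this one: [x + y + 1 = 0] gives the partial fractions of
1 / ((2 m + 1) C(2 m, m)), and [x + y + 1 = K] gives the leading coefficient. *)
Lemma gconvS (F : realFieldType) (x y u : F) n :
  (forall s, (s <= n.+1)%N -> u + s%:R != 0) ->
  (u + n.+1%:R) * gconv x y u n.+1 + (u + n%:R - y) * gconv x y u n =
  gbin (x + y + 1) n.+1.
Proof.
move=> u0; rewrite gbin_pascal -!gbin_vandermonde /gconv !mulr_sumr.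
(* Write u + n + 1 = (u + i) + (n + 1 - i): the first part cancels the denominator and leaves a
   Vandermonde sum. In the second, [gbinS] lowers the index and produces y - n + i, which added to u
   + n - y is u + i again. *)
have -> : \sum_(i < n.+2) (u + n.+1%:R) * (gbin x i * gbin y (n.+1 - i) / (u + i%:R)) =
  \sum_(i < n.+2) gbin x i * gbin y (n.+1 - i) +
  \sum_(i < n.+2) gbin x i * ((n.+1 - i)%:R * gbin y (n.+1 - i)) / (u + i%:R).
  rewrite -big_split /=; apply: eq_bigr => i _; have ui := u0 i (leq_ord i).
  by rewrite natrB ?leq_ord //; field.
rewrite [X in _ + X + _ = _]big_ord_recr /= subnn mul0r mulr0 mul0r addr0.
rewrite -addrA -big_split /=; congr (_ + _); apply: eq_bigr => i _.
have ui := u0 i (leqW (leq_ord i)).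
by rewrite subSn ?leq_ord // gbinS natrB ?leq_ord //; field.
Qed.

(** * Partial fractions of reciprocal central binomials *)

Definition inv_cbin {F : fieldType} (n : nat) : F := 'C(2 * n, n)%:R^-1.

Lemma inv_cbinS (F : realFieldType) n :
  2 * (2 * n + 1)%:R * inv_cbin n.+1 = n.+1%:R * inv_cbin n :> F.
Proof.
have E : (n.+1 * 'C(2 * n.+1, n.+1) = 2 * (2 * n + 1) * 'C(2 * n, n))%N.
  have E1 := mul_bin_diag (2 * n).+2 n.
  have E2 := mul_bin_down (2 * n).+1 n.
  rewrite (_ : (2 * n).+1 - n = n.+1)%N in E2; last by lia.
  by rewrite (_ : 2 * n.+1 = (2 * n).+2)%N; move: E1 E2 => /=; lia.
have c0 m : 'C(2 * m, m)%:R != 0 :> F by rewrite pnatr_eq0 -lt0n bin_gt0; lia.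
have := congr1 (fun m : nat => m%:R : F) E; rewrite /= !natrM => E'.
rewrite /inv_cbin; apply: (mulfI (c0 n)); apply: (mulfI (c0 n.+1)).
transitivity (2 * (2 * n + 1)%:R * 'C(2 * n, n)%:R : F); first by field; rewrite c0.
by rewrite -E'; field; rewrite c0.
Qed.

Lemma inv_cbin_block (F : realFieldType) n j :
  2 ^+ j * (\prod_(i < j) (2 * (n + i) + 1)%:R) * inv_cbin (n + j) =
  (\prod_(i < j) (n + i.+1)%:R) * inv_cbin n :> F.
Proof.
elim: j => [|j IH]; first by rewrite !big_ord0 addn0 mulr1.
rewrite !big_ord_recr /= addnS exprS.
have := inv_cbinS F (n + j); rewrite -addnS.
set p := \prod_(_ < _) _ in IH *; set q := \prod_(_ < _) _ in IH * => E.
transitivity (2 ^+ j * p * (2 * (2 * (n + j) + 1)%:R * inv_cbin (n + j.+1)) : F); first by ring.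
rewrite E; transitivity ((n + j.+1)%:R * (2 ^+ j * p * inv_cbin (n + j)) : F); first by ring.
by rewrite IH; ring.
Qed.

(** Induction on [j]: here the right side of [gconvS] is [gbin 0 j.+1 = 0], so [gconv] obeys a
    homogeneous first-order recurrence. It agrees with the one [inv_cbinS] gives for the left side,
    up to a factor -4 per step. *)
Lemma inv_cbin_parfrac (F : realFieldType) n j :
  inv_cbin (n + j) / (2 * (n + j) + 1)%:R =
  inv_cbin n * (2 * (-4) ^+ j)^-1 * gconv (-1/2) (-1/2) (n%:R + 1/2) j :> F.
Proof.
have u0 s : n%:R + 1 / 2 + s%:R != 0 :> F.
  by rewrite gt_eqF // ltr_wpDr ?ler0n // ltr_wpDl ?ler0n // divr_gt0.
have odd0 m : 2 * m%:R + 1 != 0 :> F by rewrite gt_eqF // ltr_wpDl ?mulr_ge0 ?ler0n.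
rewrite natrD natrM; elim: j => [|j IH].
  by rewrite addn0 /gconv big_ord1 /= !gbin0 expr0; field; apply: lt0r_neq0; have := ler0n F n; lra.
have := @gconvS F (-1/2) (-1/2) (n%:R + 1/2) j (fun s _ => u0 s).
have -> : -1/2 + -1/2 + 1 = 0%:R :> F by field.
rewrite gbin_nat bin0n.
have -> : n%:R + 1/2 + j.+1%:R = (2 * (n + j.+1)%:R + 1) / 2 :> F by rewrite natrD; field.
have -> : n%:R + 1/2 + j%:R - -1/2 = (n + j).+1%:R :> F by rewrite -addn1 !natrD; field.
move/eqP; rewrite addr_eq0 => /eqP E.
have c0 : (-4) ^+ j != 0 :> F by rewrite expf_neq0 // oppr_eq0 pnatr_eq0.
have T := inv_cbinS F (n + j); rewrite natrD natrM in T.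
have {}T : inv_cbin (n + j).+1 = (n + j).+1%:R / 2 * (inv_cbin (n + j) / (2 * (n + j)%:R + 1)) :> F.
  apply: (mulfI (_ : 2 * (2 * (n + j)%:R + 1) != 0)); first by rewrite mulf_neq0 ?odd0 ?pnatr_eq0.
  by rewrite T; field; apply: lt0r_neq0; have := ler0n F n; have := ler0n F j; lra.
apply: (mulfI (odd0 (n + j.+1)%N)); rewrite mulrC divfK ?odd0 // addnS T IH.
move: E; rewrite addnS; set W := gconv _ _ _ j; set W' := gconv _ _ _ j.+1.
set M := (n + j).+1%:R => E.
transitivity (inv_cbin n * (-4 * (-4) ^+ j)^-1 * ((2 * M + 1) / 2 * W')); last first.
  by rewrite exprS; field; rewrite c0.
by rewrite E; field; rewrite c0.
Qed.

(** * The convolution of the leading coefficient as a sum over odd denominators *)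

Lemma sum_bin_ord K q : (\sum_(i < K) 'C(i, q) = 'C(K, q.+1))%N.
Proof. by elim: K => [|K IH]; rewrite ?big_ord0 // big_ord_recr /= IH binS. Qed.

(** Since (q + 1) C(i, q + 1) = (i - q) C(i, q) and (q + 1/2) + (i - q) = i + 1/2, the denominators
    cancel and a hockey-stick sum remains. *)
Lemma sum_bin_half (F : realFieldType) K q :
  (q%:R + 1/2) * (\sum_(i < K) 'C(i, q)%:R / (i%:R + 1/2)) +
  q.+1%:R * (\sum_(i < K) 'C(i, q.+1)%:R / (i%:R + 1/2)) = 'C(K, q.+1)%:R :> F.
Proof.
have i0 i : i%:R + 1/2 != 0 :> F by rewrite gt_eqF // ltr_wpDl ?ler0n // divr_gt0.
rewrite !mulr_sumr -big_split -sum_bin_ord natr_sum /=; apply: eq_bigr => i _.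
rewrite [q.+1%:R * _]mulrA -natrM mul_bin_left natrM.
have [qi|iq] := leqP q i; last by rewrite bin_small //; ring.
by rewrite natrB //; field; apply: lt0r_neq0; have := ler0n F i; lra.
Qed.

(** Both sides equal 1 / (1/2 - K) at [j = 0] and satisfy the same recurrence: [gconvS] with x + y +
    1 = K, and [sum_bin_half] with q = K - 2 - j, whose factors q + 1/2 and q + 1 are those of
    [gconvS] up to sign. *)
Lemma gconv_bin (F : realFieldType) K j : (j < K)%N ->
  gconv (K%:R - 1/2) (-1/2) (1/2 - K%:R) j =
  - \sum_(i < K) 'C(i, K.-1 - j)%:R / (i%:R + 1/2) :> F.
Proof.
have u0 s : (s < K)%N -> (1/2 - K%:R) + s%:R != 0 :> F.
  move=> sK; rewrite -subr_eq0 lt_eqF //.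
  have : s.+1%:R <= K%:R :> F by rewrite ler_nat.
  rewrite -natr1; lra.
have i0 i : i%:R + 1/2 != 0 :> F by rewrite gt_eqF // ltr_wpDl ?ler0n // divr_gt0.
elim: j => [|j IH] jK.
  rewrite /gconv big_ord1 !gbin0 subn0 -(prednK jK) big_ord_recr /= binn big1.
    by rewrite -natr1; field; apply/andP; have := ler0n F K.-1; split; first [apply: lt0r_neq0; lra | apply: ltr0_neq0; lra].
  by move=> i _; rewrite bin_small ?mul0r.
have := @gconvS F (K%:R - 1/2) (-1/2) (1/2 - K%:R) j (fun s Hs => u0 s (leq_ltn_trans Hs jK)).
rewrite IH ?(ltnW jK) //.
have -> : K%:R - 1 / 2 + -1 / 2 + 1 = K%:R :> F by field.
rewrite gbin_nat => E.
apply: (mulfI (u0 _ jK)); rewrite -[LHS](addrK ((1 / 2 - K%:R + j%:R - -1 / 2) *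
     - (\sum_(i < K) 'C(i, K.-1 - j)%:R / (i%:R + 1 / 2)))) E.
have := sum_bin_half F K (K.-1 - j.+1).
have -> : (K.-1 - j.+1).+1 = (K.-1 - j)%N by lia.
have -> : 'C(K, K.-1 - j) = 'C(K, j.+1) by rewrite -(bin_sub (ltnW jK)) -subn1 -subnDA add1n.
move=> <-.
have KE : K%:R = (K.-1 - j.+1)%:R + 2 + j%:R :> F by rewrite -!natrD; congr _%:R; lia.
rewrite (_ : K.-1 - j = (K.-1 - j.+1).+1)%N; last by lia.
by rewrite KE -natr1; field.
Qed.

(** * 3-adic non-vanishing of sums over odd denominators *)

Lemma odd_reciprocal_sum_neq0 (K : nat) (m : nat -> int) : (0 < K)%N -> (forall i, ~~ (3 %| m i)%Z) ->
  \sum_(i < K) ((m i)%:~R / (2 * i + 1)%:R : rat) != 0.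
Proof.
move=> K_gt0 m3.
pose int3 (x : rat) := exists d : nat, ~~ (3 %| d)%N /\ exists z : int, x * d%:R = z%:~R.
have int3D x y : int3 x -> int3 y -> int3 (x + y).
  move=> [d [hd [z Ez]]] [d' [hd' [z' Ez']]]; exists (d * d')%N; split.
    by rewrite Euclid_dvdM // negb_or hd.
  exists (z * d'%:Z + z' * d%:Z).
  by rewrite natrM rmorphD !rmorphM /= -Ez -Ez' -!pmulrn; ring.
pose E := trunc_log 3 (2 * K - 1).
have lo : (3 ^ E <= 2 * K - 1)%N by apply: trunc_logP; lia.
have hi : (2 * K - 1 < 3 ^ E.+1)%N by apply: trunc_log_ltn.
have o3 : odd (3 ^ E) by rewrite oddX orbT.
have i0K : ((3 ^ E)./2 < K)%N by move: lo o3; lia.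
pose i0 := Ordinal i0K.
have Ei0 : (2 * i0 + 1 = 3 ^ E)%N by rewrite /=; move: o3; lia.
rewrite (bigD1 i0) //= -/(i0 : nat).
(* Scaling by 3^(E - 1), written so that E = 0 is allowed, makes every other term 3-integral, while
   the term [i0] becomes [m i0] / 3. *)
have rest : int3 (3%:R ^+ E / 3%:R * (\sum_(i < K | i != i0) ((m i)%:~R / (2 * i + 1)%:R))).
  rewrite mulr_sumr; elim/big_ind: _ => //; first by exists 1%N; split => //; exists 0; rewrite mul0r.
  move=> i ne_i.
  have i_gt0 : (0 < 2 * i + 1)%N by rewrite addn1.
  have e_lt : (logn 3 (2 * i + 1) < E)%N.
    rewrite ltnNge -pfactor_dvdn //; apply/negP => /dvdnP [c Ec].
    have iK := ltn_ord i.
    (* A positive odd multiple c 3^E with c < 3 has c = 1, which would force [i = i0]. *)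
    have c3 : (c < 3)%N.
      by rewrite -(ltn_pmul2r (expn_gt0 3 E : (0 < 3 ^ E)%N)) -Ec -expnS; lia.
    case/eqP: ne_i; apply: val_inj => /=.
    by case: c c3 Ec => [|[|[|c]]] //; lia.
  have [d nd Ed] := pfactor_coprime (isT : prime 3) i_gt0.
  exists d; split; first by rewrite -prime_coprime.
  exists (m i * (3 ^ (E - (logn 3 (2 * i + 1)).+1))%N%:Z).
  have d0 : d%:R != 0 :> rat by rewrite pnatr_eq0; apply: contraTneq nd => ->.
  have e0 : (3 ^ logn 3 (2 * i + 1))%:R != 0 :> rat by rewrite pnatr_eq0 expn_eq0.
  rewrite rmorphM /= -pmulrn {1}Ed -natrX -{1}(subnK e_lt) addnS expnS expnD !natrM.
  by field; rewrite d0 e0.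
apply/negP => /eqP sum0; move: rest.
have -> : 3%:R ^+ E / 3%:R * (\sum_(i < K | i != i0) ((m i)%:~R / (2 * i + 1)%:R)) = - (m i0)%:~R / 3%:R :> rat.
  rewrite -[X in _ * X](addKr ((m i0)%:~R / (2 * i0 + 1)%:R)) sum0 Ei0 -natrX.
  by field; rewrite pnatr_eq0 expn_eq0.
case=> d [nd [z Ez]]; move: (m3 i0); apply/negP; rewrite negbK.
have : (3 %| m i0 * d%:Z)%Z.
  apply/dvdzP; exists (- z); apply: (@intr_inj rat).
  by rewrite !rmorphM rmorphN /= -Ez -pmulrn; field.
by rewrite Gauss_dvdzl // coprimezE /= prime_coprime.
Qed.

(** * The Taylor coefficients a_m *)

(** The denominator 2 - 2 y + y^2 dictates the recurrence, and the numerator 6 - 4 y the initial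
    values a_0 = 3, a_1 = 1. *)
Fixpoint pi_coefs (n : nat) : rat * rat :=
  if n is m.+1 then let: (u, v) := pi_coefs m in (v, v - u / 2) else (3, 1).
Definition pi_coef n := (pi_coefs n).1.

Lemma pi_coefSS n : pi_coef n.+2 = pi_coef n.+1 - pi_coef n / 2.
Proof. by rewrite /pi_coef /=; case: (pi_coefs n). Qed.

(** Behind this lies 1 + y^4 / 4 = (1 - y + y^2 / 2) (1 + y + y^2 / 2). *)
Lemma pi_coef_add4 n : pi_coef n.+4 = - pi_coef n / 4.
Proof. by rewrite !pi_coefSS; field. Qed.

Lemma pi_coef_block k n j :
  pi_coef (4 * k * n + j) = pi_coef j / (-4) ^+ (k * n).
Proof.
rewrite -mulnA; elim: (k * n)%N => [|m IH]; first by rewrite muln0 divr1.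
rewrite mulnS -addnA pi_coef_add4 IH exprS.
have h : (-4) ^+ m != 0 :> rat by rewrite expf_neq0.
by field; rewrite h.
Qed.

Lemma pi_coef_bound n : `|pi_coef n| <= 3.
Proof.
suff: [&& `|pi_coef n| <= 3, `|pi_coef n.+1| <= 3, `|pi_coef n.+2| <= 3 & `|pi_coef n.+3| <= 3].
  by case/and4P.
elim: n => [|n /and4P [h0 h1 h2 h3]]; first by vm_compute.
by rewrite h1 h2 h3 pi_coef_add4 normrM normrN [`|4^-1|]gtr0_norm //; lra.
Qed.

(** * Reversed coefficients and their binomial transform modulo 3 *)

Fixpoint rev_coefs (n : nat) : int * int :=
  if n is m.+1 then let: (u, v) := rev_coefs m in (v, - 8 * v - 32 * u) else (1, -2).
(* Up to a constant factor, [pi_coef (K - 1 - n) / (-4) ^+ (K - 1 - n)] for K a multiple of 4. *)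
Definition rev_coef n := (rev_coefs n).1.

Lemma rev_coefSS n : rev_coef n.+2 = - 8 * rev_coef n.+1 - 32 * rev_coef n.
Proof. by rewrite /rev_coef /=; case: (rev_coefs n). Qed.

(** For b_m = a_m / (-4)^m, the recurrence of [pi_coef] read backwards is b_m = -8 b_(m+1) - 32
    b_(m+2). The initial ratio -2 is b_2 / b_3, because K - 1 is 3 modulo 4. *)
Lemma pi_coef_rev k q : (q < 4 * k.+1)%N ->
  pi_coef ((4 * k.+1).-1 - q) / (-4) ^+ ((4 * k.+1).-1 - q) =
  pi_coef (4 * k.+1).-1 / (-4) ^+ (4 * k.+1).-1 * (rev_coef q)%:~R.
Proof.
have -> : ((4 * k.+1).-1 = 4 * k + 3)%N by lia.
suff H r : (r.+1 < 4 * k.+1)%N -> let P q := pi_coef (4 * k + 3 - q) / (-4) ^+ (4 * k + 3 - q) =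
  pi_coef (4 * k + 3) / (-4) ^+ (4 * k + 3) * (rev_coef q)%:~R in P r /\ P r.+1.
  by case: q => [|q] hq; [case: (H 0%N) | case: (H q)] => //; lia.
elim: r => [|r IH] hr /=.
  rewrite subn0 mulr1; split=> //.
  have B j : pi_coef (4 * k + j) = pi_coef j / (-4) ^+ k.
    by have := pi_coef_block k 1 j; rewrite !muln1.
  rewrite -addnBA // !B !exprD.
  have h m : (-4) ^+ m != 0 :> rat by rewrite expf_neq0.
  rewrite [pi_coef (3 - 1)](_ : _ = -1/2) // [pi_coef 3](_ : _ = -1) // [rev_coef 1](_ : _ = -2) //.
  by rewrite rmorphN /=; field; rewrite ?h.
have := IH (ltnW hr); rewrite /=; case=> E1 E2; split=> //.
have Er : (4 * k + 3 - r = (4 * k + 3 - r.+2).+2)%N by lia.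
have Er1 : (4 * k + 3 - r.+1 = (4 * k + 3 - r.+2).+1)%N by lia.
set x0 := pi_coef (4 * k + 3) / _ in E1 E2 *.
have -> : x0 * (rev_coef r.+2)%:~R = - 8 * (x0 * (rev_coef r.+1)%:~R) - 32 * (x0 * (rev_coef r)%:~R).
  by rewrite rev_coefSS; ring.
rewrite -E1 -E2.
rewrite Er Er1; set m := (4 * k + 3 - r.+2)%N; rewrite pi_coefSS !exprS.
have h : (-4) ^+ m != 0 :> rat by rewrite expf_neq0.
by field; rewrite h.
Qed.

Lemma sum_binS (R : pzRingType) (f : nat -> R) n :
  \sum_(l < n.+2) 'C(n.+1, l)%:R * f l =
  \sum_(l < n.+1) 'C(n, l)%:R * (f l + f l.+1).
Proof.
under [RHS]eq_bigr => l _ do rewrite mulrDr.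
rewrite big_split /= [LHS]big_ord_recl /= [X in _ = X + _]big_ord_recl /= !bin0 -addrA; congr (_ + _).
under eq_bigr => l _ do rewrite /bump leq0n add1n binS natrD mulrDl.
rewrite big_split /= [X in X + _]big_ord_recr /= bin_small // mul0r addr0.
by congr (_ + _).
Qed.

(** With E the shift, this is (1 + E)^i applied to [rev_coef] and read at [q]; at [q = 0] it is the
    m_i of the overview. *)
Definition rev_bin i q : int := \sum_(l < i.+1) 'C(i, l)%:R * rev_coef (q + l).

Lemma rev_binS i q : rev_bin i.+1 q = rev_bin i q + rev_bin i q.+1.
Proof.
rewrite /rev_bin (sum_binS _ (fun l => rev_coef (q + l))) -big_split /=; apply: eq_bigr => l _.
by rewrite mulrDr addnS.
Qed.

(** E^2 = -8 E - 32 on [rev_coef], so T = 1 + E satisfies T^2 = -6 T - 25. *)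
Lemma rev_binSS i : rev_bin i.+2 0 = - 6 * rev_bin i.+1 0 - 25 * rev_bin i 0.
Proof.
have E : rev_bin i 2 = - 8 * rev_bin i 1 - 32 * rev_bin i 0.
  rewrite /rev_bin !mulr_sumr -sumrB; apply: eq_bigr => l _.
  by rewrite add2n add1n rev_coefSS add0n; ring.
by rewrite !rev_binS E; ring.
Qed.

(** Modulo 3 the recurrence reads m_(i+2) = - m_i, with initial values 1 and -1. *)
Lemma rev_bin_mod3 i : ~~ (3 %| rev_bin i 0)%Z.
Proof.
suff: ~~ (3 %| rev_bin i 0)%Z && ~~ (3 %| rev_bin i.+1 0)%Z by case/andP.
elim: i => [|i /andP [h0 h1]]; last by rewrite h1 rev_binSS; lia.
by rewrite rev_binS /rev_bin !big_ord1.
Qed.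

Lemma pi_coef_neq0 n : pi_coef (4 * n + 3) != 0.
Proof.
have := pi_coef_block n 1 3; rewrite !muln1 => ->.
rewrite [pi_coef 3](_ : _ = -1) //.
by rewrite mulf_neq0 // invr_neq0 // expf_neq0.
Qed.

Lemma gconv_sum_neq0 k : (0 < k)%N -> let K := (4 * k)%N in
  \sum_(j < K) pi_coef j / (-4) ^+ j * gconv (K%:R - 1/2) (-1/2) (1/2 - K%:R) j != 0.
Proof.
case: k => // k _; set K := (4 * k.+1)%N => /=.
under eq_bigr => j _ do rewrite gconv_bin // mulrN mulr_sumr.
rewrite sumrN oppr_eq0 exchange_big.
set x0 := pi_coef (4 * k.+1).-1 / (-4) ^+ (4 * k.+1).-1.
have x0_neq0 : x0 != 0.
  by rewrite mulf_neq0 ?invr_neq0 ?expf_neq0 // (_ : (4 * k.+1).-1 = 4 * k + 3)%N ?pi_coef_neq0 //; lia.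
(* Reversing [j] turns the inner sum into the binomial transform of [rev_coef]; the remaining sum
   over [i] has integer numerators prime to 3 and denominators 2 i + 1. *)
have E (i : 'I_K) : \sum_(j < K) pi_coef j / (-4) ^+ j * ('C(i, K.-1 - j)%:R / (i%:R + 1/2)) =
    2 * x0 * ((rev_bin i 0)%:~R / (2 * i + 1)%:R).
  rewrite (reindex_inj rev_ord_inj) /= /rev_bin rmorph_sum /= mulr_suml mulr_sumr.
  rewrite (big_ord_widen K (fun l => 2 * x0 * (('C(i, l)%:R * rev_coef (0 + l))%:~R / (2 * i + 1)%:R))) //.
  rewrite [RHS]big_mkcond /=; apply: eq_bigr => q _.
  have -> : (K - q.+1 = K.-1 - q)%N by rewrite subnS -subn1 subnAC subn1.
  rewrite pi_coef_rev // subKn; last by have := ltn_ord q; lia.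
  have n0 : i%:R + 1/2 != 0 :> rat by apply: lt0r_neq0; have := ler0n rat i; lra.
  case: ifP => [_|/negbT iq]; last by rewrite bin_small ?mul0r ?mulr0 // ltnNge -ltnS.
  rewrite rmorphM /= rmorph_nat natrD natrM -/x0; field.
  by apply: lt0r_neq0; have := ler0n rat i; lra.
under eq_bigr => i _ do rewrite E.
rewrite -mulr_sumr; apply: mulf_neq0; first by rewrite mulf_neq0.
exact: (@odd_reciprocal_sum_neq0 K (fun i => rev_bin i 0) isT rev_bin_mod3).
Qed.

(** * Cancelling the simple poles by telescoping *)

Lemma size_prod_XsubC_card (R : idomainType) (I : finType) (P : pred I) (f : I -> R) :
  size (\prod_(i | P i) ('X - (f i)%:P)) = #|P|.+1.
Proof. by rewrite -big_filter size_prod_XsubC cardE /enum_mem. Qed.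

(* The poles of [R], as a function of [N]. *)
Definition node (s : nat) : rat := - (s%:R + 1/2).
(** The product is the numerator of t_(n+1) / t_n at N = K n; the extra factor N + K is the shift of
    the factor ['X] that makes G(0) = 0. *)
Definition block_poly (K : nat) : {poly rat} :=
  ('X - (- K%:R)%:P) * \prod_(i < K) ('X - (- i.+1%:R)%:P).

Lemma block_polyE K x : (block_poly K).[x] = (x + K%:R) * \prod_(i < K) (x + i.+1%:R).
Proof.
rewrite hornerM horner_prod hornerXsubC opprK; congr (_ * _).
by apply: eq_bigr => i _; rewrite hornerXsubC opprK.
Qed.

Lemma node_shift_neq0 (s i : nat) : node s + i%:R != 0.
Proof.
apply/eqP => E.
have : (2 * i)%:R = (2 * s + 1)%:R :> rat by rewrite natrD !natrM; move: E; rewrite /node; lra.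
by move/eqP; rewrite eqr_nat; lia.
Qed.

Lemma block_poly_node_neq0 K s : (block_poly K).[node s] != 0.
Proof.
rewrite block_polyE mulf_neq0 ?node_shift_neq0 //.
by apply/prodf_neq0 => i _; rewrite node_shift_neq0.
Qed.

Lemma size_block_poly K : size (block_poly K) = K.+2.
Proof.
rewrite /block_poly size_monicM ?monicXsubC ?monic_neq0 ?monic_prod_XsubC //.
by rewrite size_XsubC size_prod_XsubC_card card_ord.
Qed.

Lemma monic_coef_size (K : nat) (p : {poly rat}) : p \is monic -> size p = K.+1 -> p`_K = 1.
Proof. by move=> /monicP; rewrite lead_coefE => E sp; rewrite -E sp. Qed.

(* With [f = block_poly K] and [z = node s], take [U = (f - f(z)) / (2 (X - z)) - G]: the ratio
[t n.+1 / t n] is [prod_i (N + i + 1)] over [prod_i (N + i + 1/2)] up to a constant, so [f t_n]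
divided by [N - z] is a polynomial multiple of [t n.+1]. *)
Lemma parfrac_reduction k (s : 'I_(4 * k)) : let K := (4 * k)%N in
  let t n : rat := inv_cbin (K * n) / (-4) ^+ (k * n) in
  let c : rat := 2 ^+ (2 * K).-1 * (-4) ^+ k in
  exists U G : {poly rat}, [/\ (size U <= K.+1)%N, U`_K = 1/2 - c, (size G <= K.+1)%N, G.[0] = 0 &
   forall n, U.[(K * n)%:R] * t n = - (block_poly K).[node s] / 2 * (t n / ((K * n)%:R + 1/2 + s%:R))
      + G.[(K * n.+1)%:R] * t n.+1 - G.[(K * n)%:R] * t n].
Proof.
move=> K t c; set b := (block_poly K).[node s].
pose p := block_poly K - b%:P.
have /factor_theorem [q Eq] : root p (node s) by rewrite /root hornerD hornerN hornerC subrr.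
have mb : block_poly K \is monic by rewrite monicMl ?monicXsubC ?monic_prod_XsubC.
have szp : size p = K.+2.
  rewrite size_polyDl size_block_poly // size_polyN.
  exact: leq_ltn_trans (size_polyC_leq1 _) _.
have mp : p \is monic.
  rewrite monicE lead_coefDl -?monicE // size_polyN size_block_poly.
  exact: leq_ltn_trans (size_polyC_leq1 _) _.
have mq : q \is monic by rewrite -(monicMr q (monicXsubC (node s))) -Eq.
have szq : size q = K.+1.
  have := szp; rewrite Eq size_Mmonic ?monicXsubC ?monic_neq0 // size_XsubC addn2 /=.
  by case.
(* Chosen so that r(N + K) is N + K times the product of all N + 1/2 + i with i <> s. The scalar [c]
   absorbs the constant 2^(2 K) (-4)^k of the ratio, halved. *)
pose r : {poly rat} := 'X * \prod_(i < K | i != s) ('X - (K%:R - i%:R - 1/2)%:P).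
have mr : r \is monic by rewrite monicMl ?monicX ?monic_prod_XsubC.
have szr : size r = K.+1.
  rewrite /r mulrC size_mulX ?monic_neq0 ?monic_prod_XsubC // size_prod_XsubC_card.
  congr _.+1; rewrite -[RHS](card_ord K) [RHS](cardD1 s) inE add1n; congr _.+1.
  by apply: eq_card => i; rewrite !inE andbT.
exists (1/2 *: q - c *: r), (c *: r); split.
- rewrite (leq_trans (size_polyD _ _)) // size_polyN geq_max.
  by rewrite !(leq_trans (size_scale_leq _ _)) ?szq ?szr.
- by rewrite coefB !coefZ !(monic_coef_size K) // !mulr1.
- by rewrite (leq_trans (size_scale_leq _ _)) ?szr.
- by rewrite hornerZ hornerM hornerX mul0r mulr0.
move=> n; rewrite !(hornerD, hornerN, hornerZ) mulrBl; congr (_ - _).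
set N := (K * n)%N.
have d0 : N%:R + 1/2 + s%:R != 0 :> rat by apply: lt0r_neq0; have := ler0n rat N; have := ler0n rat s; lra.
have -> : q.[N%:R] = ((N%:R + K%:R) * (\prod_(i < K) (N%:R + i.+1%:R)) - b) / (N%:R + 1/2 + s%:R).
  apply: (mulIf d0); rewrite divfK // -block_polyE.
  have := congr1 (fun p => p.[N%:R]) Eq; rewrite /p hornerM hornerXsubC hornerD hornerN hornerC => ->.
  by rewrite /node; ring.
have -> : r.[(K * n.+1)%:R] = (N%:R + K%:R) * \prod_(i < K | i != s) (N%:R + 1/2 + i%:R).
  rewrite mulnSr -/N natrD /r hornerM hornerX horner_prod; congr (_ * _).
  by apply: eq_bigr => i _; rewrite hornerXsubC; ring.
have := inv_cbin_block rat N K.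
have -> : \prod_(i < K) (N + i.+1)%:R = \prod_(i < K) (N%:R + i.+1%:R) :> rat.
  by apply: eq_bigr => i _; rewrite natrD.
have -> : 2 ^+ K * \prod_(i < K) (2 * (N + i) + 1)%:R = 2 ^+ (2 * K) * \prod_(i < K) (N%:R + 1/2 + i%:R) :> rat.
  rewrite mul2n -addnn exprD -mulrA; congr (_ * _); rewrite -[in 2 ^+ K](card_ord K) -prodr_const -big_split /=.
  by apply: eq_bigr => i _; rewrite natrD natrM natrD; field.
rewrite (bigD1 s) //= => E.
rewrite /t mulnSr -/N mulnSr exprD.
have K0 : (0 < 2 * K)%N by have := ltn_ord s; rewrite -/K; lia.
rewrite -(prednK K0) exprS in E.
have e0 m : (-4) ^+ m != 0 :> rat by rewrite expf_neq0.
set P := \prod_(_ < _) _ in E *; set Q := \prod_(_ < _ | _) _ in E *.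
rewrite /c.
transitivity (1/2 * ((N%:R + K%:R) * (P * inv_cbin N) - b * inv_cbin N) / (N%:R + 1/2 + s%:R) / (-4) ^+ (k * n)).
  by field; rewrite e0; apply: lt0r_neq0; have := ler0n rat N; have := ler0n rat s; lra.
rewrite -E; field; rewrite !e0; apply: lt0r_neq0; have := ler0n rat N; have := ler0n rat s; lra.
Qed.

(** This rewrites [gbin (-1/2) s] over [block_poly] at [node s] in the form summed by [gconv]. From
    s to s + 1 the product gains the factor [node s] and loses [node s + K%:R], as the ratio of the
    two [gbin] requires. *)
Lemma gbin_block K s :
  gbin (-1/2) s * \prod_(i < K) (node 0 + i.+1%:R) =
  gbin (K%:R - 1/2) s * \prod_(i < K) (node s + i.+1%:R) :> rat.
Proof.
elim: s => [|s IH]; first by rewrite !gbin0.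
apply: (mulfI (_ : s.+1%:R != 0)); first by rewrite pnatr_eq0.
rewrite !mulrA !gbinS -!mulrA IH.
have : \prod_(i < K.+1) (node s + i%:R) = \prod_(i < K.+1) (node s + i%:R) by [].
rewrite {1}big_ord_recl big_ord_recr /= => E.
have -> : \prod_(i < K) (node s.+1 + i.+1%:R) = \prod_(i < K) (node s + i%:R).
  by apply: eq_bigr => i _; rewrite /node -!natr1; ring.
transitivity (gbin (K%:R - 1/2) s * ((node s + 0) * \prod_(i < K) (node s + i.+1%:R))).
  by rewrite /node; field.
by rewrite E /node; field.
Qed.

Lemma triangle_swap (R : comPzRingType) K (x h g : nat -> R) :
  \sum_(s < K) (\sum_(j < K | (s <= j)%N) x j * h s * h (j - s)%N) * g s =
  \sum_(j < K) x j * \sum_(s < j.+1) h s * h (j - s)%N * g s.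
Proof.
under eq_bigr => s _ do rewrite mulr_suml.
rewrite (exchange_big_dep xpredT) //=; apply: eq_bigr => j _.
rewrite mulr_sumr (big_ord_widen_cond K xpredT (fun s => x j * (h s * h (j - s)%N * g s))) //=.
by apply: eq_bigr => s _; rewrite !mulrA.
Qed.

Lemma telescoped_poly k : (0 < k)%N -> let K := (4 * k)%N in
  let t n : rat := inv_cbin (K * n) / (-4) ^+ (k * n) in
  exists S G : {poly rat}, [/\ size S = K.+1, (size G <= K.+1)%N, G.[0] = 0 &
   forall n, S.[(K * n)%:R] * t n =
      \sum_(j < K) pi_coef (K * n + j) * (inv_cbin (K * n + j) / (2 * (K * n + j) + 1)%:R)
      + G.[(K * n.+1)%:R] * t n.+1 - G.[(K * n)%:R] * t n].
Proof.
move=> k_gt0 K t.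
pose c : rat := 2 ^+ (2 * K).-1 * (-4) ^+ k.
have [U /fin_all_exists [G UG]] := fin_all_exists (@parfrac_reduction k).
pose x j : rat := pi_coef j / (-4) ^+ j.
pose h := gbin (-1/2 : rat).
pose rho (s : 'I_K) : rat := \sum_(j < K | (s <= j)%N) x j * h s * h (j - s)%N.
(* [rho s] is the residue weight of the pole in the grouped series; this multiple of [U s]
   reproduces exactly that pole. *)
pose w s : rat := rho s / - (block_poly K).[node s].
have w0 : \sum_(s < K) w s != 0.
  rewrite /w /rho (@triangle_swap rat K x h (fun s => (- (block_poly K).[node s])^-1)).
  pose a0 := \prod_(i < K) (node 0 + i.+1%:R).
  have a00 : a0 != 0 by apply/prodf_neq0 => i _; rewrite node_shift_neq0.
  have E s : h s / - (block_poly K).[node s] = a0^-1 * (gbin (K%:R - 1/2) s / (1/2 - K%:R + s%:R)).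
    apply: (mulfI a00); rewrite mulVKf // mulrA [a0 * _]mulrC gbin_block block_polyE.
    have As0 : \prod_(i < K) (node s + i.+1%:R) != 0 by apply/prodf_neq0 => i _; rewrite node_shift_neq0.
    have d0 := node_shift_neq0 s K.
    have -> : 1/2 - K%:R + s%:R = - (node s + K%:R) by rewrite /node; ring.
    by move: d0 As0; set d := node s + K%:R; set A := \prod_(_ < _) _ => d0 A0; field; rewrite A0 d0.
  rewrite (_ : \sum_(j < K) _ = a0^-1 * \sum_(j < K) x j * gconv (K%:R - 1/2) (-1/2) (1/2 - K%:R) j).
    by apply: mulf_neq0; [rewrite invr_neq0 | exact: (@gconv_sum_neq0 k k_gt0)].
  rewrite mulr_sumr; apply: eq_bigr => j _; rewrite mulrCA; congr (_ * _).
  rewrite mulr_sumr; apply: eq_bigr => s _; rewrite mulrAC E /h; ring.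
pose S := \sum_(s < K) w s *: U s.
exists S, (\sum_(s < K) w s *: G s); split.
- apply/eqP; rewrite eqn_leq; apply/andP; split.
    rewrite (leq_trans (size_sum _ _ _)) //; apply/bigmax_leqP => s _.
    by rewrite (leq_trans (size_scale_leq _ _)) //; case: (UG s).
  rewrite ltnNge; apply/negP => /leq_sizeP /(_ K (leqnn K)) /eqP; apply/negP.
  rewrite coef_sum.
  have UK s : (U s)`_K = 1/2 - c by case: (UG s).
  under eq_bigr => s _ do rewrite coefZ UK.
  (* The coefficient is the sum of the [w s] times 1/2 - c, and |2 c| = 2^(2 K) 4^k > 1 excludes c =
     1/2. *)
  rewrite -mulr_suml mulf_neq0 // subr_eq0; apply/eqP => E.
  have K0 : (0 < 2 * K)%N by rewrite /K; lia.
  have : 2 ^+ (2 * K) * (-4) ^+ k = 1 :> rat by rewrite -(prednK K0) exprS -mulrA -/c -E; field.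
  move/(congr1 Num.norm); rewrite normrM !normrX normrN normr1 !ger0_norm //.
  have h1 : 1 < 2 ^+ (2 * K) :> rat by rewrite exprn_egt1 // -lt0n.
  have h2 : 1 <= 4 ^+ k :> rat by rewrite exprn_ege1.
  nra.
- rewrite (leq_trans (size_sum _ _ _)) //; apply/bigmax_leqP => s _.
  by rewrite (leq_trans (size_scale_leq _ _)) //; case: (UG s).
- by rewrite horner_sum big1 // => s _; rewrite hornerZ; case: (UG s) => _ _ _ -> _; rewrite mulr0.
move=> n; rewrite !horner_sum !mulr_suml.
transitivity (\sum_(s < K) (rho s / 2 * (t n / ((K * n)%:R + 1/2 + s%:R)) 
   + (w s *: G s).[(K * n.+1)%:R] * t n.+1 - (w s *: G s).[(K * n)%:R] * t n)).
  apply: eq_bigr => s _; rewrite !hornerZ -mulrA.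
  have -> : (U s).[(K * n)%:R] * t n = - (block_poly K).[node s] / 2 * (t n / ((K * n)%:R + 1/2 + s%:R))
      + (G s).[(K * n.+1)%:R] * t n.+1 - (G s).[(K * n)%:R] * t n by case: (UG s).
  rewrite /w; move: (block_poly_node_neq0 K s); set b := (block_poly K).[_] => b0.
  by set y := t n / _; field; exact: b0.
rewrite sumrB big_split /=; congr (_ + _ - _).
have := @triangle_swap rat K x h (fun s => t n / 2 / ((K * n)%:R + 1/2 + s%:R)).
rewrite (_ : \sum_(s < K) _ = \sum_(s < K) rho s / 2 * (t n / ((K * n)%:R + 1/2 + s%:R))) => [->|]; last first.
  by apply: eq_bigr => s _; rewrite /rho; ring.
apply: eq_bigr => j _; rewrite inv_cbin_parfrac pi_coef_block /gconv !mulr_sumr.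
apply: eq_bigr => s _; rewrite /x /t -/K.
have e0 m : (-4) ^+ m != 0 :> rat by rewrite expf_neq0.
have d0 : (K * n)%:R + 1/2 + s%:R != 0 :> rat.
  by apply: lt0r_neq0; have := ler0n rat (K * n)%N; have := ler0n rat s; lra.
by rewrite /h !invfM; ring.
Qed.

(** * Regrouping and growth estimates *)

Lemma sum_blocks (V : nmodType) (f : nat -> V) K M :
  \sum_(n < M) \sum_(j < K) f (K * n + j)%N = \sum_(m < K * M) f m.
Proof.
elim: M => [|M IH]; first by rewrite muln0 !big_ord0.
rewrite big_ord_recr IH /= mulnSr [RHS]big_split_ord.
by congr (_ + _); apply: eq_bigr.
Qed.

Lemma inv_cbin_le (F : realFieldType) n : 0 <= (inv_cbin n : F) <= (2 ^+ n)^-1.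
Proof.
elim: n => [|n /andP [lo hi]]; first by rewrite /inv_cbin bin0 expr0 invr1 ler01 lexx.
have := inv_cbinS F n; rewrite natrD natrM -[n.+1%:R]natr1 exprS invfM.
have n0 := ler0n F n; set T := inv_cbin n in lo hi *; set T' := inv_cbin n.+1 => E.
have d0 : 0 < 2 * (2 * n%:R + 1) :> F by lra.
have -> : T' = T * ((n%:R + 1) / (2 * (2 * n%:R + 1))).
  by apply: (mulfI (lt0r_neq0 d0)); rewrite E; field; apply: lt0r_neq0; lra.
have h0 : 0 <= (n%:R + 1) / (2 * (2 * n%:R + 1)) :> F by rewrite divr_ge0 //; lra.
have h1 : (n%:R + 1) / (2 * (2 * n%:R + 1)) <= 1/2 :> F by rewrite ler_pdivrMr //; lra.
by rewrite mulr_ge0 //= [leRHS]mulrC ler_pM // -[2^-1]mul1r.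
Qed.

(** This growth is what [inv_cbin_le] at K n absorbs, so that the power of -4 in t_n drives the
    boundary terms to 0. *)
Lemma poly_geometric_bound (p : {poly rat}) K : (size p <= K.+1)%N ->
  exists C, forall n : nat, `|p.[n%:R]| <= C * 2 ^+ (K * n).
Proof.
move=> sp; exists (\sum_(i < size p) `|p`_i|) => n.
rewrite horner_coef mulr_suml (le_trans (ler_norm_sum _ _ _)) // ler_sum // => i _.
rewrite normrM ler_wpM2l // normrX normr_nat -natrX -[2 in leRHS]/(2%:R) -natrX ler_nat.
apply: leq_trans (_ : (2 ^ n) ^ i <= _)%N; first by case: (nat_of_ord i) => // m; rewrite leq_exp2r // ltnW // ltn_expl.
by rewrite -expnM leq_exp2l // mulnC leq_mul2r -ltnS (leq_trans (ltn_ord i)) ?orbT.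
Qed.

(** * Beta integrals and the ungrouped series for pi *)

(* Integration by parts of [(1 - 2 x) (x - x^2)^(n + 1)]. *)
Fixpoint beta_prim {F : realFieldType} (m : nat) : {poly F} :=
  if m is n.+1 then
    ((4 * n + 6)%:R)^-1 *: (n.+1%:R *: beta_prim n - (1 - 2%:R *: 'X) * ('X - 'X ^+ 2) ^+ n.+1)
  else 'X.

Lemma deriv_beta_prim (F : realFieldType) m : (beta_prim m : {poly F})^`() = ('X - 'X ^+ 2) ^+ m.
Proof.
elim: m => [|n IH]; first by rewrite derivX.
rewrite /= derivZ derivB derivZ IH derivM derivB derivZ derivX derivC.
rewrite deriv_exp derivB derivX derivXn /=.
have c0 : (4 * n + 6)%:R != 0 :> F by rewrite pnatr_eq0 addn_eq0 andbF.
apply: (scalerI c0); rewrite scalerA divff // scale1r !scaler_nat.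
rewrite expr1 [_ ^+ n.+1]exprS; set P := _ ^+ n.
rewrite -(mulr_natr P) -(mulr_natr ((1 - 'X *+ 2) * P)) -[RHS]mulr_natr -[n.+1%:R]natr1 natrD natrM; ring.
Qed.

(** The boundary term vanishes at 0 and 1, so the increments follow the recurrence of
    [inv_cbinS]. *)
Lemma beta_prim_int (F : realFieldType) m :
  (beta_prim m).[1] - (beta_prim m).[0] = inv_cbin m / (2 * m + 1)%:R :> F.
Proof.
elim: m => [|n IH]; first by rewrite /= !hornerX /inv_cbin bin0; field.
rewrite /= !(hornerZ, hornerD, hornerN, hornerM, horner_exp, hornerX, hornerC, hornerXn).
have -> : 1 - 1 ^+ 2 = 0 :> F by ring.
have -> : 0 - 0 ^+ 2 = 0 :> F by ring.
rewrite !expr0n /= !mulr0 !subr0.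
have := inv_cbinS F n; rewrite -[inv_cbin n](divfK (_ : (2 * n + 1)%:R != 0)); last by rewrite pnatr_eq0 addn1.
rewrite -IH; set b := _ - _ => E.
have o' : (2 * n + 1)%:R != 0 :> F by rewrite pnatr_eq0 addn1.
have o m : 2 * m%:R + 1 != 0 :> F by apply: lt0r_neq0; have := ler0n F m; lra.
have {}E : inv_cbin n.+1 = n.+1%:R * b / 2.
  apply: (mulfI (_ : 2 * (2 * n + 1)%:R != 0)); first by rewrite mulf_eq0 negb_or o' pnatr_eq0.
  by rewrite E; field.
have E2 : (2 * n.+1 + 1)%:R = 2 * n%:R + 3 :> F by rewrite -addn1 !(natrD, natrM); ring.
rewrite E E2 /b natrD natrM; field.
by apply/andP; split; apply: lt0r_neq0; have := ler0n F n; lra.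
Qed.

Lemma pi_coef_genfun (R : realType) (y : R) M :
  (2 - 2 * y + y ^+ 2) * (\sum_(m < M) ratr (pi_coef m) * y ^+ m) =
  6 - 4 * y - 2 * ratr (pi_coef M) * y ^+ M
  + 2 * (ratr (pi_coef M) - ratr (pi_coef M.+1)) * y ^+ M.+1.
Proof.
elim: M => [|M IH].
  rewrite big_ord0 [pi_coef 0](_ : _ = 3%:R) // [pi_coef 1](_ : _ = 1%:R) // !ratr_nat; ring.
by rewrite big_ord_recr /= mulrDr IH pi_coefSS rmorphB fmorph_div /= ratr_nat !exprS; field.
Qed.

(** The mean value theorem stands in for integration: [f] is a primitive of the truncation error,
    f(1) - f(0) is the sum minus pi, and its derivative is the remainder of [pi_coef_genfun] over a
    denominator at least 1, with 0 <= y <= 1/4. *)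
Lemma pi_series_bound (R : realType) M :
  `|\sum_(m < M) ratr (pi_coef m) * (inv_cbin m / (2 * m + 1)%:R) - (pi : R)| <= 18 * (4 ^- M).
Proof.
pose p : {poly R} := \sum_(m < M) ratr (pi_coef m) *: beta_prim m.
pose f (x : R) : R := p.[x] - 2 * atan x - 2 * atan (x - 1).
pose b n : R := ratr (pi_coef n).
pose df (x : R) : R := - (2 * b M * (x - x ^+ 2) ^+ M - 2 * (b M - b M.+1) * (x - x ^+ 2) ^+ M.+1) /
  (2 - 2 * (x - x ^+ 2) + (x - x ^+ 2) ^+ 2).
have fd (x : R) : is_derive x 1 f (df x).
  rewrite /f.
  apply: is_derive_eq.
  set y := x - x ^+ 2.
  have -> : p^`().[x] = \sum_(m < M) b m * y ^+ m.
    rewrite /p raddf_sum horner_sum /=; apply: eq_bigr => m _.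
    by rewrite derivZ deriv_beta_prim hornerZ horner_exp !hornerE.
  have x1 : 1 + x ^+ 2 != 0 by rewrite lt0r_neq0 // ltr_pwDl // sqr_ge0.
  have x2 : 1 + (x - 1) ^+ 2 != 0 by rewrite lt0r_neq0 // ltr_pwDl // sqr_ge0.
  have D : 2 - 2 * y + y ^+ 2 = (1 + x ^+ 2) * (1 + (x - 1) ^+ 2) by rewrite /y; ring.
  have := pi_coef_genfun R y M; rewrite /df -/y D => E.
  apply: (mulfI (mulf_neq0 x1 x2)); rewrite subr0 mulr1 !mulrBr E [RHS]mulrC divfK ?mulf_neq0 //.
  by rewrite -![2 *: _]/(2 * _) /b /y; field; rewrite x1 x2.
have fc : {within `[0, 1], continuous f}.
  apply: continuous_subspaceT => x.
  by apply/differentiable_continuous/derivable1_diffP; case: (fd x).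
have [c] := MVT_segment ler01 (fun x _ => fd x) fc.
rewrite subr0 mulr1 in_itv /= => /andP [c0 c1] E.
have -> : \sum_(m < M) ratr (pi_coef m) * (inv_cbin m / (2 * m + 1)%:R) - pi = f 1 - f 0.
  rewrite /f subrr sub0r atan0 atanN atan1 mulr0 !subr0.
  rewrite (_ : \sum_(m < M) _ = p.[1] - p.[0]); first by field.
  rewrite /p !horner_sum -sumrB; apply: eq_bigr => m _.
  by rewrite !hornerZ -mulrBr beta_prim_int.
rewrite E /df.
have bb n : `|b n| <= 3.
  by rewrite /b -ratr_norm -[3](ratr_nat R 3) ler_rat pi_coef_bound.
have y0 : 0 <= c - c ^+ 2 by nra.
have y1 : c - c ^+ 2 <= 1/4 by have := sqr_ge0 (c - 1/2); rewrite sqrrB; lra.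
set y := c - c ^+ 2 in y0 y1 *.
have yM : y ^+ M <= 4 ^- M by rewrite -exprVn lerXn2r ?nnegrE // -[4^-1]mul1r.
have yM0 : 0 <= y ^+ M by rewrite exprn_ge0.
have d1 : 1 <= 2 - 2 * y + y ^+ 2 by nra.
rewrite normrM normfV (ger0_norm (le_trans ler01 d1)) ler_pdivrMr ?(lt_le_trans ltr01) //.
(* 18 = 6 + 12, from |b| <= 3 and y <= 1. *)
have : `|- (2 * b M * y ^+ M - 2 * (b M - b M.+1) * y ^+ M.+1)| <= 18 * y ^+ M.
  rewrite normrN (le_trans (ler_normB _ _)) // exprS.
  move: (b M) (b M.+1) (bb M) (bb M.+1) => u v u3 v3; have w6 := ler_normB u v.
  rewrite !normrM (ger0_norm y0) (ger0_norm yM0) (ger0_norm (ler0n R 2)).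
  have : 2 * `|u| * y ^+ M <= 6 * y ^+ M by rewrite ler_wpM2r //; lra.
  have : 2 * `|u - v| * (y * y ^+ M) <= 12 * y ^+ M.
    rewrite mulrA ler_wpM2r //; have := normr_ge0 (u - v); nra.
  lra.
nra.
Qed.

(** * Convergence of the telescoped series to pi *)

Theorem theorem1 (k : nat) (hk : (1 <= k)%N) :
  exists S : {poly rat},
    size S = (4 * k).+1 /\
    forall R : realType, series (pi_term R k S) @ \oo --> (pi : R).
Proof.
have [S [G [szS szG G0 ST]]] := telescoped_poly k hk.
pose K := (4 * k)%N.
have K0 : K%:R != 0 :> rat by rewrite pnatr_eq0 /K; lia.
pose t n : rat := inv_cbin (K * n) / (-4) ^+ (k * n).
(* [S] and [G] are polynomials in N = K n; composing with [L] passes to the variable n and keeps the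
   degree. *)
pose L : {poly rat} := K%:R *: 'X.
have compL (p : {poly rat}) n : (p \Po L).[n%:R] = p.[(K * n)%:R].
  by rewrite horner_comp /L hornerZ hornerX natrM.
have szL : size L = 2%N by rewrite /L size_scale ?size_polyX.
exists (S \Po L); split; first by rewrite size_comp_poly2.
move=> R.
have [C HC] : exists C, forall n : nat, `|G.[(K * n)%:R]| <= C * 2 ^+ (K * n).
  have szGL : (size (G \Po L) <= K.+1)%N by rewrite size_comp_poly2.
  have [C HC] := poly_geometric_bound (G \Po L) K szGL; exists C => n.
  by rewrite -compL.
have tail n : `|G.[(K * n)%:R] * t n| <= C * 4 ^- n.
  have C0 : 0 <= C by have := HC 0%N; rewrite muln0 mulr1; apply: le_trans; exact: normr_ge0.
  have := inv_cbin_le rat (K * n); rewrite /t; move: (inv_cbin _) => T /andP [T0 T1].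
  rewrite !normrM normfV normrX normrN [`|4|]ger0_norm // [`|T|]ger0_norm // mulrA.
  rewrite ler_pM ?mulr_ge0 ?invr_ge0 ?exprn_ge0 //.
    rewrite -[leRHS](mulfK (_ : 2 ^+ (K * n) != 0)) ?expf_neq0 //.
    by rewrite ler_pM.
  by rewrite lef_pV2 ?posrE ?exprn_gt0 // ler_weXn2l // leq_pmull.
(* The telescoping leaves only the upper boundary term, as G(0) = 0. *)
have partial n : series (pi_term R k (S \Po L)) n =
    \sum_(m < K * n) ratr (pi_coef m) * (inv_cbin m / (2 * m + 1)%:R) + ratr (G.[(K * n)%:R] * t n).
  rewrite seriesEord /=.
  have -> : \sum_(m < K * n) ratr (pi_coef m) * (inv_cbin m / (2 * m + 1)%:R) =
     ratr (\sum_(m < K * n) pi_coef m * (inv_cbin m / (2 * m + 1)%:R)) :> R.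
    rewrite rmorph_sum /=; apply: eq_bigr => m _.
    by rewrite rmorphM fmorph_div /inv_cbin /= fmorphV /= !ratr_nat.
  rewrite -(sum_blocks _ (fun m => pi_coef m * (inv_cbin m / (2 * m + 1)%:R))) -rmorphD /=.
  elim: n => [|n IH].
    by rewrite !big_ord0 muln0 G0 mul0r addr0 rmorph0.
  rewrite !big_ord_recr /= IH.
  have -> : pi_term R k (S \Po L) n = ratr (S.[(K * n)%:R] * t n).
    rewrite /pi_term compL [RHS]rmorphM /=; congr (_ * _).
    rewrite /t /inv_cbin -invfM fmorphV rmorphM rmorphXn /= rmorphN /= !ratr_nat.
    by congr (('C(_, _)%:R * _)^-1); rewrite /K !mulnA.
  rewrite -rmorphD ST; congr ratr; rewrite -/K -/(t n) -/(t n.+1); ring.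
have bnd n : `|series (pi_term R k (S \Po L)) n - pi| <= geometric (18 + ratr C) (4^-1) n.
  rewrite partial addrAC (le_trans (ler_normD _ _)) // /geometric /= mulrDl lerD //.
    rewrite (le_trans (pi_series_bound R _)) // ler_wpM2l // exprVn.
    by rewrite lef_pV2 ?posrE ?exprn_gt0 // ler_weXn2l ?ler1n // leq_pmull // /K; lia.
  rewrite -ratr_norm; apply: le_trans (_ : ratr (C * 4 ^- n) <= _).
    by rewrite ler_rat.
  by rewrite rmorphM fmorphV rmorphXn /= ratr_nat exprVn.
apply/subr_cvg0; apply/norm_cvg0P.
have gc := @cvg_geometric R (18 + ratr C) 4^-1.
apply: squeeze_cvgr (cvg_cst 0) (gc _).
  apply: nearW => n; rewrite normr_ge0; exact: bnd.
by rewrite ger0_norm //; lra.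
Qed.
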